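(* Fix a choice of sign and let $m=(-3\pm i)^k$ with $k\in\mathbb{N}$, $k\geq1$. Then there exists a Gaussian integer $a$ with $\gcd(a,m)=1$ and $a/m\in\mathfrak{F}$ such that $K_{\mathbb{C}}(a/m)\leq 3\sqrt{2}$.
   Context: $\mathfrak{F}=\{z\in\mathbb{C}: -\tfrac12\leq\mathrm{Re}(z)<\tfrac12,\ -\tfrac12\leq\mathrm{Im}(z)<\tfrac12\}$. For $z\in\mathbb{C}$, $[z]:=\lfloor \mathrm{Re}(z)+\tfrac12\rfloor+i\lfloor \mathrm{Im}(z)+\tfrac12\rfloor$. The complex Gauss map $T:\mathfrak{F}\to\mathfrak{F}$ is $T(z)=z^{-1}-[z^{-1}]$ for $z\neq0$, $T(0)=0$. For $z\in\mathfrak{F}\setminus\{0\}$, $a_1(z)=[z^{-1}]$ and, while $T^{n-1}(z)\neq0$, $a_n(z)=a_1(T^{n-1}(z))$; for $z\in\mathbb{Q}(i)\cap\mathfrak{F}$ this process terminates, giving the Hurwitz continued fraction $z=[a_1(z),\ldots,a_n(z)]_{\mathbb{C}}$. Define $K_{\mathbb{C}}(z)=\max(|a_1(z)|,\ldots,|a_n(z)|)$. *)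

(* Defs.v *)
From HB Require Import structures.
From mathcomp Require Import all_boot all_order all_algebra.
From mathcomp Require Import ring lra.
From mathcomp Require Import boolp classical_sets reals.
From mathcomp Require Import complex.

Set Implicit Arguments.
Unset Strict Implicit.
Unset Printing Implicit Defensive.

Import Order.TTheory GRing.Theory Num.Theory.
Local Open Scope ring_scope.
Local Open Scope complex_scope.

Definition gaussian_integer (R : realType) (z : R[i]) : Prop :=
  complex.Re z \is a Num.int /\ complex.Im z \is a Num.int.

Definition gaussian_dvd (R : realType) (d a : R[i]) : Prop :=
  exists2 c : R[i], gaussian_integer c & a = d * c.

(* g is a greatest common divisor of a and b in Z[i]; it is determined only up
   to a unit, so gcd(a, b) = 1 reads gaussian_gcd a b 1. *)
Definition gaussian_gcd (R : realType) (a b g : R[i]) : Prop :=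
  [/\ gaussian_integer g, gaussian_dvd g a, gaussian_dvd g b
    & forall d, gaussian_integer d ->
        gaussian_dvd d a -> gaussian_dvd d b -> gaussian_dvd d g].

Definition hurwitz_domain (R : realType) : set R[i] :=
  [set z | - 2^-1 <= complex.Re z < 2^-1 /\
           - 2^-1 <= complex.Im z < 2^-1]%classic.

Definition nearest_gaussian (R : realType) (z : R[i]) : R[i] :=
  (Num.floor (complex.Re z + 2^-1))%:~R +i*
  (Num.floor (complex.Im z + 2^-1))%:~R.

Definition gauss_map (R : realType) (z : R[i]) : R[i] :=
  if z == 0 then 0 else z^-1 - nearest_gaussian z^-1.

(* a_n(z) for n >= 1, meaningful only when T^(n-1)(z) <> 0. *)
Definition partial_quotient (R : realType) (n : nat) (z : R[i]) : R[i] :=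
  nearest_gaussian (iter n.-1 (@gauss_map R) z)^-1.

Definition hurwitz_length_spec (R : realType) (z : R[i]) (n : nat) : Prop :=
  iter n (@gauss_map R) z = 0 /\
  forall j, (j < n)%N -> iter j (@gauss_map R) z != 0.

(* The number n of partial quotients of z; the junk value 0 is taken when the
   process does not terminate, which hurwitz_lengthP below excludes for z in
   Q(i) and in the domain. *)
Definition hurwitz_length (R : realType) (z : R[i]) : nat :=
  xget 0%N [set n | hurwitz_length_spec z n]%classic.

(* normc z is the modulus of z as an element of R (the norm `|z| has type
   R[i]); all terms are nonnegative, so the unit 0 of the max is harmless. *)
Definition K_C (R : realType) (z : R[i]) : R :=
  \big[Num.max/0]_(1 <= j < (hurwitz_length z).+1)
    ComplexField.Normc.normc (partial_quotient j z).

Local Definition nrm (R : realType) (z : R[i]) : R :=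
  complex.Re z ^+ 2 + complex.Im z ^+ 2.

Lemma nrmM (R : realType) (z w : R[i]) : nrm (z * w) = nrm z * nrm w.
Proof. by case: z w => [a b] [c d]; rewrite /nrm /=; ring. Qed.

Lemma nrm_ge0 (R : realType) (z : R[i]) : 0 <= nrm z.
Proof. by rewrite addr_ge0 // sqr_ge0. Qed.

Lemma nrm_eq0 (R : realType) (z : R[i]) : (nrm z == 0) = (z == 0).
Proof.
case: z => a b; rewrite /nrm /= paddr_eq0 ?sqr_ge0 // !sqrf_eq0.
by rewrite eq_complex.
Qed.

Lemma nearest_itv (R : realType) (x : R) :
  - 2^-1 <= x - (Num.floor (x + 2^-1))%:~R < 2^-1.
Proof.
by have /andP[] := floor_itv (x + 2^-1); rewrite intrD => *; apply/andP; split; lra.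
Qed.

Lemma sub_nearest_domain (R : realType) (z : R[i]) :
  hurwitz_domain (z - nearest_gaussian z).
Proof. by case: z => a b; split; exact: nearest_itv. Qed.

Lemma gaussian_integer_nearest (R : realType) (z : R[i]) :
  gaussian_integer (nearest_gaussian z).
Proof. by split; rewrite /= intr_int. Qed.

Lemma gaussian_integerM (R : realType) (z w : R[i]) :
  gaussian_integer z -> gaussian_integer w -> gaussian_integer (z * w).
Proof.
case: z w => [a b] [c d] [/= ha hb] [/= hc hd].
by split; rewrite /= ?rpredB ?rpredD ?rpredM.
Qed.

Lemma gaussian_integerB (R : realType) (z w : R[i]) :
  gaussian_integer z -> gaussian_integer w -> gaussian_integer (z - w).
Proof.
by case: z w => [a b] [c d] [/= ha hb] [/= hc hd]; split; rewrite /= rpredB.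
Qed.

Lemma nrm_domain (R : realType) (z : R[i]) : hurwitz_domain z -> 2 * nrm z <= 1.
Proof. by case: z => a b [/= /andP[? ?] /andP[? ?]]; rewrite /nrm /=; nra. Qed.

Lemma nrm_int_lt1 (R : realType) (z : R[i]) :
  gaussian_integer z -> nrm z < 1 -> z = 0.
Proof.
move=> [ha hb] z1; apply/eqP; rewrite -nrm_eq0; apply/eqP.
have /intrP[n En] : nrm z \is a Num.int by rewrite rpredD // rpredX.
move: z1 (nrm_ge0 z); rewrite En -[1]/(1%:~R) ltr_int -[0]/(0%:~R) ler_int.
by case: n {En} => [[|n]|n].
Qed.

Lemma gauss_map_terminates (R : realType) (p q : R[i]) :
  gaussian_integer p -> gaussian_integer q -> q != 0 ->
  hurwitz_domain (p / q) -> exists n, iter n (@gauss_map R) (p / q) = 0.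
Proof.
have [N hN] : exists N : nat, nrm q < 2 ^+ N.
  exists (Num.truncn (nrm q)).+1.
  have := truncnS_gt (nrm q); move/lt_trans; apply.
  by rewrite -natrX ltr_nat ltn_expl.
elim: N p q hN => [|N IH] p q hN hp hq q0 dom.
  by move: q0; rewrite (nrm_int_lt1 hq hN) eqxx.
have [p0|p0] := eqVneq p 0; first by exists 0%N; rewrite p0 mul0r.
set c := nearest_gaussian (q / p).
have E : gauss_map (p / q) = (q - c * p) / p.
  rewrite /gauss_map mulf_eq0 invr_eq0 (negPf p0) (negPf q0) /=.
  by rewrite invf_div mulrBl mulfK.
have hc : gaussian_integer c by exact: gaussian_integer_nearest.
have [|||n Hn] := IH (q - c * p) p _ _ hp p0.
- have : nrm p = nrm (p / q) * nrm q by rewrite -nrmM divfK.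
  have := nrm_domain dom; have := nrm_ge0 q; move: hN; rewrite exprS.
  by nra.
- exact: gaussian_integerB hq (gaussian_integerM hc hp).
- by rewrite mulrBl mulfK //; exact: sub_nearest_domain.
- by exists n.+1; rewrite iterSr E.
Qed.

Lemma hurwitz_lengthP (R : realType) (p q : R[i]) :
  gaussian_integer p -> gaussian_integer q -> q != 0 ->
  hurwitz_domain (p / q) ->
  hurwitz_length_spec (p / q) (hurwitz_length (p / q)).
Proof.
move=> hp hq q0 dom.
have ex : exists n, iter n (@gauss_map R) (p / q) == 0.
  by have [n Hn] := gauss_map_terminates hp hq q0 dom; exists n; exact/eqP.
apply: (@xgetPex _ 0%N [set n | hurwitz_length_spec (p / q) n]%classic).
case: (ex_minnP ex) => n /eqP Hn min; exists n; split=> // j.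
by rewrite ltnNge; apply: contra; exact: min.
Qed.

(* Main.v *)
(** The denominator of a continued fraction with digits [w] is the continuant
    [K(w)].  Up to sign, two folds square it: [K(w, x, - rev w) = x K(w)^2], and
    folding [w = v d] around the unit [i] and absorbing that unit gives
    [K(v, d - i, - d - i, - rev v) = K(w)^2].  Start from the one-letter word
    [q = -3 + i] or [q = -3 - i]: the first fold with [x = q] takes the
    denominator [q^j] to [q^(2j+1)], the second to [q^(2j)].  On words of length
    at least 2 a fold keeps the first digit [c] and makes [- c] the last one, so
    the digits that are shifted by [i] always come from the two base words of
    exponents 2 and 3, and all digits have norm between 8 and 18.  Norm at least
    8 keeps every tail inside the disc of radius 1/2, so the word is the Hurwitz
    expansion of its value; norm at most 18 is the bound on [K_C]. *)
Require Import Defs.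
From mathcomp Require Import all_boot all_order all_algebra.
From mathcomp Require Import boolp classical_sets reals.
From mathcomp Require Import complex.
From mathcomp Require Import ring lra zify.

Set Implicit Arguments.
Unset Strict Implicit.
Unset Printing Implicit Defensive.

Import Order.TTheory GRing.Theory Num.Theory.
Local Open Scope ring_scope.
Local Open Scope complex_scope.

(** * Continuants and the folding identities *)

(** A pair (p, q) stands for p/q, and 1/(a + p/q) = q/(a q + p). Keeping pairs avoids division. *)
Definition cf_step (C : comNzRingType) (a : C) (z : C * C) : C * C :=
  (z.2, a * z.2 + z.1).

Definition cf_pair (C : comNzRingType) (w : seq C) : C * C :=
  foldr (@cf_step C) (0, 1) w.

(* The continuant of [w] without its last letter, with value 0 at [[::]]. *)
Definition cf_den_belast (C : comNzRingType) (w : seq C) : C :=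
  (foldr (@cf_step C) (1, 0) w).2.

Lemma cf_step_linear (C : comNzRingType) (w : seq C) (x y : C) :
  (foldr (@cf_step C) (x, y) w).2 =
  (cf_pair w).2 * y + cf_den_belast w * x.
Proof.
suff H : foldr (@cf_step C) (x, y) w =
    ((cf_pair w).1 * y + (foldr (@cf_step C) (1, 0) w).1 * x,
     (cf_pair w).2 * y + cf_den_belast w * x) by rewrite H.
rewrite /cf_den_belast; elim: w => [|a w IH] /=.
  by congr pair; ring.
by rewrite IH /cf_step /=; congr pair; ring.
Qed.

Lemma cf_den_cat (C : comNzRingType) (u v : seq C) :
  (cf_pair (u ++ v)).2 =
  (cf_pair u).2 * (cf_pair v).2 + cf_den_belast u * (cf_pair v).1.
Proof.
rewrite -cf_step_linear -surjective_pairing.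
by rewrite /cf_pair foldr_cat.
Qed.

Lemma cf_den_rcons (C : comNzRingType) (w : seq C) (a : C) :
  (cf_pair (rcons w a)).2 = (cf_pair w).2 * a + cf_den_belast w.
Proof. by rewrite -cats1 cf_den_cat /=; ring. Qed.

Lemma cf_den_belast_rcons (C : comNzRingType) (w : seq C) (a : C) :
  cf_den_belast (rcons w a) = (cf_pair w).2.
Proof.
by rewrite /cf_den_belast -cats1 foldr_cat /= cf_step_linear /=; ring.
Qed.

(** A step is the symmetric matrix with rows (0, 1) and (1, a), so transposing a product of steps
    reverses the word. *)
Lemma cf_pair_rev (C : comNzRingType) (w : seq C) :
  cf_pair (rev w) = (cf_den_belast w, (cf_pair w).2).
Proof.
elim/last_ind: w => [|w a IH] //.
rewrite rev_rcons /= -/(cf_pair _) IH cf_den_belast_rcons cf_den_rcons.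
by rewrite /cf_step /=; congr pair; ring.
Qed.

Lemma cf_pair_opp (C : comNzRingType) (w : seq C) :
  cf_pair (map -%R w) =
  (- (-1) ^+ size w * (cf_pair w).1, (-1) ^+ size w * (cf_pair w).2).
Proof.
elim: w => [|a w IH] /=; first by congr pair; ring.
by rewrite -/(cf_pair _) IH /cf_step /= exprS; congr pair; ring.
Qed.

(** Negating the reversed half flips the sign of its numerator relative to its denominator, so the
    two terms in [cf_den_belast w] cancel. *)
Lemma cf_den_fold (C : comNzRingType) (w : seq C) (x : C) :
  (cf_pair (w ++ x :: map -%R (rev w))).2 =
  (-1) ^+ size w * x * (cf_pair w).2 ^+ 2.
Proof.
rewrite cf_den_cat /= -/(cf_pair _) cf_pair_opp cf_pair_rev size_rev /=.
by ring.
Qed.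

(* Folding [w = v d] around [i] gives [v, d, i, -d, - rev v]; the unit letter
   [i] is absorbed by d + 1/(i + 1/y) = (d - i) + 1/(y - i). *)
Lemma cf_den_fold_unit (C : comNzRingType) (i : C) (v : seq C) (d : C) :
  i ^+ 2 = -1 ->
  (cf_pair (v ++ [:: d - i, - d - i & map -%R (rev v)])).2 =
  (-1) ^+ (size v).+1 * (cf_pair (rcons v d)).2 ^+ 2.
Proof.
move=> i2; rewrite cf_den_cat /= -/(cf_pair _) cf_pair_opp cf_pair_rev size_rev.
rewrite cf_den_rcons /= exprS.
set e := (-1) ^+ _; set A := (cf_pair v).2; set B := cf_den_belast v.
by apply/eqP; rewrite -subr_eq0; apply/eqP; ring: i2.
Qed.

(** * Words of Hurwitz digits and their expansions *)

Definition cf_value (F : fieldType) (w : seq F) : F :=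
  foldr (fun a z => (a + z)^-1) 0 w.

Definition hurwitz_digit (R : realType) (a : R[i]) : bool :=
  [&& complex.Re a \is a Num.int, complex.Im a \is a Num.int
    & 8 <= Defs.nrm a <= 18].

Lemma hurwitz_digitN (R : realType) (a : R[i]) :
  hurwitz_digit (- a) = hurwitz_digit a.
Proof.
by case: a => x y; rewrite /hurwitz_digit /Defs.nrm /= !rpredN !sqrrN.
Qed.

Lemma digit_gaussian_integer (R : realType) (a : R[i]) :
  hurwitz_digit a -> gaussian_integer a.
Proof. by case/and3P. Qed.

Lemma nrm_digit_add (R : realType) (a z : R[i]) :
  hurwitz_digit a -> Defs.nrm z < 4^-1 -> 4 < Defs.nrm (a + z).
Proof.
case/and3P=> _ _ /andP[]; case: a z => [a b] [x y].
rewrite /Defs.nrm /= => h _ hz.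
(* These squares give |a|^2 <= (5/4) |a + z|^2 + 5 |z|^2, hence |a + z|^2 > 27/5. *)
have := sqr_ge0 ((a + x) / 2 + 2 * x); have := sqr_ge0 ((b + y) / 2 + 2 * y).
by nra.
Qed.

Lemma nrm1 (R : realType) : Defs.nrm (1 : R[i]) = 1.
Proof. by rewrite /Defs.nrm /=; ring. Qed.

Lemma nrm_cf_value (R : realType) (w : seq R[i]) :
  all (@hurwitz_digit R) w -> Defs.nrm (cf_value w) < 4^-1.
Proof.
elim: w => [_|a w IH /= /andP[da /IH hw]] /=.
  by rewrite /Defs.nrm /=; lra.
have h := nrm_digit_add da hw; set z := a + _ in h *.
have z0 : z != 0 by rewrite -nrm_eq0; lra.
have : Defs.nrm z * Defs.nrm z^-1 = 1 by rewrite -nrmM divff // nrm1.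
have := nrm_ge0 z^-1; set t := Defs.nrm z^-1; set s := Defs.nrm z in h *.
by nra.
Qed.

Lemma digit_add_neq0 (R : realType) (a : R[i]) (w : seq R[i]) :
  hurwitz_digit a -> all (@hurwitz_digit R) w -> a + cf_value w != 0.
Proof.
by move=> da /nrm_cf_value /(nrm_digit_add da) h; rewrite -nrm_eq0; lra.
Qed.

Lemma nearest_gaussian_add (R : realType) (a z : R[i]) :
  gaussian_integer a -> Defs.nrm z < 4^-1 -> nearest_gaussian (a + z) = a.
Proof.
case: a z => [a b] [x y] [/= /intrP[p ->] /intrP[q ->]].
rewrite /Defs.nrm /= => h.
have hf (n : int) (t : R) : t ^+ 2 < 4^-1 -> Num.floor (n%:~R + t + 2^-1) = n.
  by move=> ht; apply: floor_def; rewrite intrD; apply/andP; split; nra.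
have := sqr_ge0 x; have := sqr_ge0 y => hy hx.
by rewrite /nearest_gaussian /= !hf //; lra.
Qed.

(** The Gauss map deletes the leading digit. Past the end of the word both sides are 0, because 0 is
    a fixed point. *)
Lemma iter_gauss_map_cf (R : realType) (w : seq R[i]) (j : nat) :
  all (@hurwitz_digit R) w ->
  iter j (@gauss_map R) (cf_value w) = cf_value (drop j w).
Proof.
elim: j w => [|j IH] w dw; first by rewrite drop0.
rewrite iterSr; case: w dw => [_|a w /= /andP[da dw]] /=.
  have -> : gauss_map (0 : R[i]) = 0 by rewrite /gauss_map eqxx.
  exact: (IH [::]).
rewrite -IH // /gauss_map invr_eq0 (negPf (digit_add_neq0 da dw)) invrK.
rewrite nearest_gaussian_add ?nrm_cf_value //; last exact: digit_gaussian_integer.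
by rewrite addrAC subrr add0r.
Qed.

Lemma cf_value_eq0 (R : realType) (w : seq R[i]) :
  all (@hurwitz_digit R) w -> (cf_value w == 0) = (w == [::]).
Proof.
case: w => [|a w] /=; first by rewrite !eqxx.
by case/andP=> da dw; rewrite invr_eq0 (negPf (digit_add_neq0 da dw)).
Qed.

Lemma all_drop (T : Type) (p : pred T) (w : seq T) (j : nat) :
  all p w -> all p (drop j w).
Proof. by rewrite -{1}(cat_take_drop j w) all_cat => /andP[]. Qed.

Lemma hurwitz_length_cf (R : realType) (w : seq R[i]) :
  all (@hurwitz_digit R) w -> hurwitz_length (cf_value w) = size w.
Proof.
move=> dw; rewrite /hurwitz_length.
have spec : hurwitz_length_spec (cf_value w) (size w).
  split=> [|j jw]; rewrite iter_gauss_map_cf ?drop_size //.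
  by rewrite cf_value_eq0 ?all_drop // -size_eq0 size_drop subn_eq0 -ltnNge.
(* The value chosen by [xget] satisfies the specification because [size w] does; both are the first
   zero of the orbit, so they agree. *)
have [h0 h1] : hurwitz_length_spec (cf_value w)
    (xget 0%N [set n | hurwitz_length_spec (cf_value w) n]%classic).
  by apply: (@xgetPex _ 0%N [set n | hurwitz_length_spec _ n]%classic); exists (size w).
case: spec => s0 s1; set n := xget _ _ in h0 h1 *.
case: (ltngtP n (size w)) => // hn.
  by move: (s1 _ hn); rewrite h0 eqxx.
by move: (h1 _ hn); rewrite s0 eqxx.
Qed.

Lemma partial_quotient_cf (R : realType) (w : seq R[i]) (j : nat) :
  all (@hurwitz_digit R) w -> (j < size w)%N ->
  partial_quotient j.+1 (cf_value w) = nth 0 w j.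
Proof.
move=> dw jw; rewrite /partial_quotient /= iter_gauss_map_cf //.
have := all_drop j dw; rewrite (drop_nth 0 jw) /= => /andP[da dr].
rewrite invrK nearest_gaussian_add ?nrm_cf_value //.
exact: digit_gaussian_integer.
Qed.

Lemma K_C_cf (R : realType) (w : seq R[i]) :
  all (@hurwitz_digit R) w -> K_C (cf_value w) <= 3%:R * Num.sqrt 2%:R.
Proof.
move=> dw; rewrite /K_C hurwitz_length_cf // big_add1 big_nat.
apply: bigmax_le => [|j /andP[_ jw]]; first by rewrite mulr_ge0 ?sqrtr_ge0.
rewrite partial_quotient_cf //.
have : hurwitz_digit (nth 0 w j) by exact: (allP dw) (mem_nth _ jw).
case: (nth 0 w j) => x y /and3P[_ _ /andP[_]]; rewrite /Defs.nrm /= => h.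
have -> : 3 * Num.sqrt 2 = Num.sqrt (18 : R).
  have -> : (18 : R) = 3 ^+ 2 * 2 by ring.
  by rewrite sqrtrM ?exprn_ge0 // sqrtr_sqr ger0_norm.
exact: ler_wsqrtr.
Qed.

(** * Divisibility in the Gaussian integers and coprimality *)

Lemma gaussian_integerD (R : realType) (z w : R[i]) :
  gaussian_integer z -> gaussian_integer w -> gaussian_integer (z + w).
Proof.
by case: z w => [a b] [c d] [/= ha hb] [/= hc hd]; split; rewrite /= rpredD.
Qed.

Lemma gaussian_integer0 (R : realType) : gaussian_integer (0 : R[i]).
Proof. by split; rewrite /= rpred0. Qed.

Lemma gaussian_integer1 (R : realType) : gaussian_integer (1 : R[i]).
Proof. by split; rewrite /= ?rpred1 ?rpred0. Qed.

Lemma gaussian_integer_sign (R : realType) (n : nat) :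
  gaussian_integer ((-1) ^+ n : R[i]).
Proof.
elim: n => [|n IH]; first exact: gaussian_integer1.
rewrite exprS mulN1r -sub0r.
exact: gaussian_integerB (gaussian_integer0 R) IH.
Qed.

Lemma gaussian_dvdMl (R : realType) (d c z : R[i]) :
  gaussian_integer c -> gaussian_dvd d z -> gaussian_dvd d (c * z).
Proof.
move=> hc [x hx ->]; exists (c * x); first exact: gaussian_integerM.
by ring.
Qed.

Lemma gaussian_dvdB (R : realType) (d z w : R[i]) :
  gaussian_dvd d z -> gaussian_dvd d w -> gaussian_dvd d (z - w).
Proof.
move=> [x hx ->] [y hy ->]; exists (x - y); first exact: gaussian_integerB.
by ring.
Qed.

Lemma gaussian_integer_cf_pair (R : realType) (w : seq R[i]) :
  all (@hurwitz_digit R) w ->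
  gaussian_integer (cf_pair w).1 /\ gaussian_integer (cf_pair w).2.
Proof.
elim: w => [_|a w IH /= /andP[/digit_gaussian_integer ha /IH[h1 h2]]].
  by split; [exact: gaussian_integer0 | exact: gaussian_integer1].
split=> //=; exact: gaussian_integerD (gaussian_integerM ha h2) h1.
Qed.

(** Removing a digit is a step of Euclid's algorithm, so a common divisor descends to the starting
    pair (0, 1). *)
Lemma cf_pair_coprime (R : realType) (w : seq R[i]) (d : R[i]) :
  all (@hurwitz_digit R) w ->
  gaussian_dvd d (cf_pair w).1 -> gaussian_dvd d (cf_pair w).2 ->
  gaussian_dvd d 1.
Proof.
elim: w => [|a w IH /= /andP[/digit_gaussian_integer ha dw] h1 h2] //=.
apply: IH => //.
have -> : (cf_pair w).1 = a * (cf_pair w).2 + (cf_pair w).1 - a * (cf_pair w).2.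
  by ring.
by apply: gaussian_dvdB => //; exact: gaussian_dvdMl.
Qed.

Lemma cf_valueE (R : realType) (w : seq R[i]) :
  all (@hurwitz_digit R) w ->
  (cf_pair w).2 != 0 /\ cf_value w = (cf_pair w).1 / (cf_pair w).2.
Proof.
elim: w => [_|a w IH /= /andP[da dw]] /=; first by rewrite oner_neq0 mul0r.
have [q0 E] := IH dw; have := digit_add_neq0 da dw; rewrite -/(cf_pair w) E.
move: (cf_pair w) q0 => [p q] /= q0.
have -> : a + p / q = (a * q + p) / q by rewrite mulrDl mulfK.
by rewrite mulf_eq0 invr_eq0 negb_or invf_div => /andP[].
Qed.

(** * Building the words by repeated folding *)

(* Letters allowed at the ends of a word: a fold around [i] puts [d - i] and
   [- d - i] in the middle. *)
Definition foldable_digit (R : realType) (d : R[i]) : bool :=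
  [&& hurwitz_digit d, hurwitz_digit (d - 'i%C) & hurwitz_digit (d + 'i%C)].

Lemma foldable_digitN (R : realType) (d : R[i]) :
  foldable_digit (- d) = foldable_digit d.
Proof.
rewrite /foldable_digit -opprD hurwitz_digitN -(hurwitz_digitN (d - _)).
by rewrite opprB [- d + _]addrC hurwitz_digitN [X in _ && X]andbC.
Qed.

(** Both ends are kept foldable: [d] may be shifted by the next fold, and [- c] becomes the new last
    letter. The sign is left free, to be absorbed by the numerator. *)
Lemma fold_word (R : realType) (m : R[i]) :
  foldable_digit m -> foldable_digit (m - 'i%C) -> foldable_digit (- m - 'i%C) ->
  forall k, (2 <= k)%N -> exists c s d n,
    [/\ foldable_digit c, foldable_digit d, all (@hurwitz_digit R) s
      & (cf_pair (c :: rcons s d)).2 = (-1) ^+ n * m ^+ k].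
Proof.
move=> fm fm1 fm2; have i2 : 'i%C ^+ 2 = -1 :> R[i] by rewrite sqr_i.
have fd d : foldable_digit d -> hurwitz_digit d by case/and3P.
have allN (s : seq R[i]) : all (@hurwitz_digit R) (map -%R (rev s)) =
    all (@hurwitz_digit R) s.
  by rewrite all_map -(all_rev _ s); apply: eq_all => x /=; rewrite hurwitz_digitN.
elim/ltn_ind=> k IH k2.
(* In a one-letter word the unit fold would also change the first letter, so the induction starts at
   exponents 2 and 3; from 4 on, [k./2] is at least 2. *)
have [->|k_neq2] := eqVneq k 2%N.
  exists (m - 'i%C), [::], (- m - 'i%C), 1%N; split=> //.
  by have := cf_den_fold_unit [::] m i2; rewrite /= => ->; ring.
have [->|k_neq3] := eqVneq k 3%N.
  exists m, [:: m], (- m), 1%N; split=> //=; first by rewrite foldable_digitN.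
    by rewrite fd.
  by have := cf_den_fold [:: m] m; rewrite /= => ->; ring.
have hk : (k./2 < k)%N by lia.
have hk2 : (2 <= k./2)%N by lia.
have [c [s [d [n [fc fd' ds E]]]]] := IH _ hk hk2.
case: (boolP (odd k)) => ok.
  (* Squaring removes the old sign; the new one comes from the length of [c :: rcons s d]. *)
  exists c, (rcons s d ++ m :: map -%R (rev (rcons s d))), (- c), (size s).+2.
  split=> //; first by rewrite foldable_digitN.
    by rewrite all_cat /= allN !all_rcons ds !fd.
  have -> : c :: rcons (rcons s d ++ m :: map -%R (rev (rcons s d))) (- c) =
      (c :: rcons s d) ++ m :: map -%R (rev (c :: rcons s d)).
    by rewrite rev_cons map_rcons cat_cons rcons_cat.
  have -> : m ^+ k = m * (m ^+ k./2) ^+ 2.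
    by rewrite -exprM -exprS; congr (_ ^+ _); lia.
  by rewrite cf_den_fold E /= size_rcons exprMn sqrr_sign; ring.
exists c, (s ++ [:: d - 'i%C, - d - 'i%C & map -%R (rev s)]), (- c), (size s).+2.
have [/and3P[d0 d1 d2]] := fd'.
split=> //; first by rewrite foldable_digitN.
  by rewrite all_cat /= allN ds d1 -opprD hurwitz_digitN d2.
have -> : c :: rcons (s ++ [:: d - 'i%C, - d - 'i%C & map -%R (rev s)]) (- c) =
    (c :: s) ++ [:: d - 'i%C, - d - 'i%C & map -%R (rev (c :: s))].
  by rewrite rev_cons map_rcons cat_cons rcons_cat.
have -> : m ^+ k = (m ^+ k./2) ^+ 2.
  by rewrite -exprM; congr (_ ^+ _); lia.
by rewrite cf_den_fold_unit // rcons_cons E /= exprMn sqrr_sign; ring.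
Qed.

Lemma bounded_digits_word (R : realType) (m : R[i]) (k : nat) :
  foldable_digit m -> foldable_digit (m - 'i%C) -> foldable_digit (- m - 'i%C) ->
  (1 <= k)%N -> exists w n,
    all (@hurwitz_digit R) w /\ (cf_pair w).2 = (-1) ^+ n * m ^+ k.
Proof.
move=> fm fm1 fm2; have fd d : foldable_digit d -> @hurwitz_digit R d by case/and3P.
case: k => [|[|k]] // _.
  by exists [:: m], 0%N; split; [rewrite /= fd | rewrite /=; ring].
have [c [s [d [n [fc fd' ds E]]]]] := fold_word fm fm1 fm2 (isT : (2 <= k.+2)%N).
by exists (c :: rcons s d), n; rewrite /= all_rcons ds !fd.
Qed.

Lemma hurwitz_domain_cf (R : realType) (w : seq R[i]) :
  all (@hurwitz_digit R) w -> hurwitz_domain (cf_value w).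
Proof.
move/nrm_cf_value; case: (cf_value w) => x y; rewrite /Defs.nrm /= => h.
by split=> /=; apply/andP; split; nra.
Qed.

(** Moves the norm bounds to integers, where computation decides them. *)
Lemma hurwitz_digitI (R : realType) (x y : int) (z : R[i]) :
  z = x%:~R + y%:~R * 'i%C -> 8 <= x ^+ 2 + y ^+ 2 <= 18 -> hurwitz_digit z.
Proof.
have -> : x%:~R + y%:~R * 'i%C = x%:~R +i* y%:~R :> R[i].
  by rewrite [RHS]complexE /= !(rmorph_int (real_complex R)) mulrC.
move=> ->; rewrite /hurwitz_digit /Defs.nrm /= !intr_int /= -!rmorphXn -rmorphD.
by rewrite -(ler_int R) -(ler_int R _ 18).
Qed.

Lemma foldable_digitI (R : realType) (x y : int) (z : R[i]) :
  z = x%:~R + y%:~R * 'i%C ->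
  [&& 8 <= x ^+ 2 + y ^+ 2 <= 18, 8 <= x ^+ 2 + (y - 1) ^+ 2 <= 18
    & 8 <= x ^+ 2 + (y + 1) ^+ 2 <= 18] ->
  foldable_digit z.
Proof.
move=> -> /and3P[h0 h1 h2]; apply/and3P; split.
- exact: hurwitz_digitI h0.
- by apply: hurwitz_digitI h1; ring.
- by apply: hurwitz_digitI h2; ring.
Qed.

Theorem theorem5p1 (R : realType) (k : nat) (m : R[i]) :
  (1 <= k)%N ->
  (m = (- 3%:R + 'i%C) ^+ k \/ m = (- 3%:R - 'i%C) ^+ k) ->
  exists a : R[i],
    [/\ gaussian_integer a,
        gaussian_gcd a m 1,
        hurwitz_domain (a / m)
      & K_C (a / m) <= 3%:R * Num.sqrt 2%:R].
Proof.
move=> k1 hm.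
have [w [n [dw E]]] : exists w n,
    all (@hurwitz_digit R) w /\ (cf_pair w).2 = (-1) ^+ n * m.
  case: hm => ->; apply: bounded_digits_word => //.
  (* For each base b the three goals are b, b - i and - b - i. The bound 18 is attained by the
     shifts 3 - 3i and -3 - 3i. *)
  - by apply: (@foldable_digitI R (-3) 1) => //; ring.
  - by apply: (@foldable_digitI R (-3) 0) => //; ring.
  - by apply: (@foldable_digitI R 3 (-2)) => //; ring.
  - by apply: (@foldable_digitI R (-3) (-1)) => //; ring.
  - by apply: (@foldable_digitI R (-3) (-2)) => //; ring.
  - by apply: (@foldable_digitI R 3 0) => //; ring.
have [ha hq] := gaussian_integer_cf_pair dw.
have [q0 V] := cf_valueE dw; have sg := gaussian_integer_sign R n.
have s2 : (-1) ^+ n * (-1) ^+ n = 1 :> R[i] by rewrite -expr2 sqrr_sign.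
(* The denominator of [w] is [m] up to the sign, which therefore moves to the numerator. *)
exists ((-1) ^+ n * (cf_pair w).1).
have -> : (-1) ^+ n * (cf_pair w).1 / m = cf_value w.
  by rewrite V E invfM invr_sign mulrA [_.1 * _]mulrC.
split; [exact: gaussian_integerM| |exact: hurwitz_domain_cf|exact: K_C_cf].
split; first exact: gaussian_integer1.
- by exists ((-1) ^+ n * (cf_pair w).1); [exact: gaussian_integerM | rewrite mul1r].
- exists m; last by rewrite mul1r.
  by rewrite -[m]mul1r -s2 -mulrA -E; exact: gaussian_integerM.
- move=> d _ da dm; apply: (cf_pair_coprime dw).
  + by rewrite -[_.1]mul1r -s2 -mulrA; exact: gaussian_dvdMl.
  + by rewrite E; exact: gaussian_dvdMl.
Qed.
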